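(* Let $R$ be a commutative ring with identity, $J$ an ideal of $R$, $M$ an $R$-module, and let $F$ and $N_2$ be submodules of $M$. Then: (1) $F\bowtie J$ is a 2-absorbing submodule of the $(R\bowtie J)$-module $M\bowtie J$ if and only if $F$ is a 2-absorbing submodule of the $R$-module $M$. (2) $\overline{N_2}$ is a 2-absorbing submodule of the $(R\bowtie J)$-module $M\bowtie J$ if and only if $N_2$ is a 2-absorbing submodule of the $R$-module $M$.
   Context: All rings are commutative with identity and all modules are unital. For a submodule $F$ of an $R$-module $M$, $(F:_R M)=\{r\in R: rM\subseteq F\}$. A proper submodule $F$ of an $R$-module $M$ is called 2-absorbing if whenever $a,b\in R$, $m\in M$ and $abm\in F$, then $ab\in(F:_R M)$ or $am\in F$ or $bm\in F$. The amalgamated duplication of $R$ along $J$ is the subring $R\bowtie J=\{(r,r+j): r\in R,\ j\in J\}$ of $R\times R$. The duplication of $M$ along $J$ is $M\bowtie J=\{(m,m')\in M\times M: m-m'\in JM\}$, an $(R\bowtie J)$-module under $(r,r+j)\cdot(m,m')=(rm,(r+j)m')$. For submodules $F,N_2$ of $M$, put $F\bowtie J=\{(n,m)\in F\times M: n-m\in JM\}$ and $\overline{N_2}=\{(m,n)\in M\times N_2: m-n\in JM\}$; both are submodules of $M\bowtie J$. *)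

(* Defs.v *)
From HB Require Import structures.
From mathcomp Require Import all_boot all_order all_algebra.
From mathcomp Require Import boolp.

Set Implicit Arguments.
Unset Strict Implicit.
Unset Printing Implicit Defensive.

Import GRing.Theory.
Local Open Scope ring_scope.

(* Rings are [comPzRingType], so the zero ring is allowed. A submodule of
   [M : lmodType R] is an [F : submodClosed M], and an ideal of [R], not
   necessarily proper, is a [J : submodClosed R^o]. These are boolean
   predicates, but [`[< P >]] turns any proposition into a boolean, so every
   subset is of this form. *)

Section TwoAbsorbing.
Variables (R : comPzRingType) (M : lmodType R).

Definition residual (F : submodClosed M) : {pred R} :=
  [pred r | `[< forall m : M, r *: m \in F >]].

Definition proper_submod (F : submodClosed M) : Prop :=
  exists m : M, m \notin F.

Definition two_absorbing (F : submodClosed M) : Prop :=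
  proper_submod F /\
  forall (a b : R) (m : M), (a * b) *: m \in F ->
    [\/ a * b \in residual F, a *: m \in F | b *: m \in F].

End TwoAbsorbing.

Section IdealMul.
Variables (R : comPzRingType) (M : lmodType R) (J : submodClosed R^o).

Definition ideal_mul : {pred M} :=
  [pred x | `[< exists (n : nat) (a : 'I_n -> R) (m : 'I_n -> M),
    (forall i, a i \in J) /\ x = \sum_(i < n) a i *: m i >]].

Lemma mem_ideal_mul (a : R) (m : M) : a \in J -> a *: m \in ideal_mul.
Proof.
move=> Ja; apply/asboolP; exists 1, (fun=> a), (fun=> m).
by split=> //; rewrite big_ord1.
Qed.

Fact ideal_mul_closed : submod_closed ideal_mul.
Proof.
split=> [|c x y /asboolP[n [a [m [Ja ->]]]] /asboolP[p [b [k [Jb ->]]]]].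
  apply/asboolP; exists 0, (fun=> 0), (fun=> 0).
  by split=> [[]//|]; rewrite big_ord0.
apply/asboolP; exists (n + p)%N,
  (fun i => match split i with inl i => c * a i | inr j => b j end),
  (fun i => match split i with inl i => m i | inr j => k j end).
split=> [i|].
  by case: (split i) => j //; exact: (rpredZ c (Ja j)).
rewrite big_split_ord /= scaler_sumr; congr (_ + _).
  by apply: eq_bigr => i _; rewrite (unsplitK (inl i)) scalerA.
by apply: eq_bigr => i _; rewrite (unsplitK (inr i)).
Qed.
HB.instance Definition _ :=
  GRing.isSubmodClosed.Build R M ideal_mul ideal_mul_closed.

End IdealMul.
Arguments ideal_mul {R} M J.

Section DupRing.
Variables (R : comPzRingType) (J : submodClosed R^o).

Definition dup_ring_pred : {pred R * R} :=
  [pred x | `[< exists r j : R, j \in J /\ x = (r, r + j) >]].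

Lemma dup_ringP (x : R * R) : (x \in dup_ring_pred) = (x.2 - x.1 \in J).
Proof.
apply/asboolP/idP => [[r [j [Jj ->]]] /=|Jx]; first by rewrite addrC addKr.
by exists x.1, (x.2 - x.1); rewrite [x.1 + _]addrC subrK -surjective_pairing.
Qed.

Fact dup_ring_closed : subring_closed dup_ring_pred.
Proof.
split=> [|x y|x y]; rewrite !dup_ringP /=.
- by rewrite subrr; exact: (rpred0 J).
- move=> Jx Jy.
  have -> : x.2 - y.2 - (x.1 - y.1) = (x.2 - x.1) - (y.2 - y.1).
    by rewrite !opprD !opprK addrACA.
  rewrite -[- (y.2 - y.1)]mulN1r.
  exact: (rpredD Jx (rpredZ (-1) Jy)).
- move=> Jx Jy.
  have -> : x.2 * y.2 - x.1 * y.1 = y.2 * (x.2 - x.1) + x.1 * (y.2 - y.1).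
    by rewrite !mulrBr ![y.2 * _]mulrC addrA subrK.
  exact: (rpredD (rpredZ y.2 Jx) (rpredZ x.1 Jy)).
Qed.
HB.instance Definition _ :=
  GRing.isSubringClosed.Build (R * R)%type dup_ring_pred dup_ring_closed.

Record dup_ring := DupRing {
  dup_ring_val : R * R;
  dup_ring_valP : dup_ring_val \in dup_ring_pred }.

HB.instance Definition _ := [isSub for dup_ring_val].
HB.instance Definition _ := [Choice of dup_ring by <:].
HB.instance Definition _ := GRing.SubChoice_isSubComPzRing.Build
  (R * R)%type dup_ring_pred dup_ring dup_ring_closed.

End DupRing.

Section DupMod.
Variables (R : comPzRingType) (M : lmodType R) (J : submodClosed R^o).

Definition dup_mod_pred : {pred M * M} :=
  [pred x | x.1 - x.2 \in ideal_mul M J].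

Lemma dup_modE (x : M * M) :
  (x \in dup_mod_pred) = (x.1 - x.2 \in ideal_mul M J).
Proof. by []. Qed.

Fact dup_mod_closed : zmod_closed dup_mod_pred.
Proof.
split=> [|x y]; rewrite !dup_modE /= ?subrr ?rpred0 // => Jx Jy.
by rewrite opprD addrACA -opprD rpredB.
Qed.
HB.instance Definition _ :=
  GRing.isZmodClosed.Build (M * M)%type dup_mod_pred dup_mod_closed.

Record dup_mod := DupMod {
  dup_mod_val : M * M;
  dup_mod_valP : dup_mod_val \in dup_mod_pred }.

HB.instance Definition _ := [isSub for dup_mod_val].
HB.instance Definition _ := [Choice of dup_mod by <:].
HB.instance Definition _ := [SubChoice_isSubZmodule of dup_mod by <:].

Fact dup_scale_subproof (r : dup_ring J) (x : dup_mod) :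
  ((\val r).1 *: (\val x).1, (\val r).2 *: (\val x).2) \in dup_mod_pred.
Proof.
have := valP r; have := valP x; rewrite dup_ringP !dup_modE /= => Jx Jr.
set r1 := (\val r).1 in Jr *; set r2 := (\val r).2 in Jr *.
set x1 := (\val x).1 in Jx *; set x2 := (\val x).2 in Jx *.
have -> : r1 *: x1 - r2 *: x2 = r1 *: (x1 - x2) - (r2 - r1) *: x2.
  by rewrite scalerBr scalerBl opprB addrA subrK.
by apply: rpredB; [exact: rpredZ | exact: mem_ideal_mul].
Qed.

Definition dup_scale (r : dup_ring J) (x : dup_mod) : dup_mod :=
  DupMod (dup_scale_subproof r x).

Fact dup_scaleA r s x : dup_scale r (dup_scale s x) = dup_scale (r * s) x.
Proof. by apply: val_inj; rewrite /= !scalerA. Qed.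

Fact dup_scale1 : left_id 1 dup_scale.
Proof.
by move=> x; apply: val_inj; rewrite /= !scale1r -surjective_pairing.
Qed.

Fact dup_scaleDr : right_distributive dup_scale +%R.
Proof. by move=> r x y; apply: val_inj; rewrite /= !scalerDr. Qed.

Fact dup_scaleDl x : {morph dup_scale^~ x : r s / r + s}.
Proof. by move=> r s; apply: val_inj; rewrite /= !scalerDl. Qed.

HB.instance Definition _ := GRing.Zmodule_isLmodule.Build (dup_ring J) dup_mod
  dup_scaleA dup_scale1 dup_scaleDr dup_scaleDl.

End DupMod.
Arguments dup_mod_pred {R} M J.
Arguments dup_mod {R} M J.

Section DupSubmod.
Variables (R : comPzRingType) (M : lmodType R) (J : submodClosed R^o).
Variable F : submodClosed M.

Definition dup_submod : {pred dup_mod M J} :=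
  [pred x | ((\val x).1 \in F) &&
            ((\val x).1 - (\val x).2 \in ideal_mul M J)].

Definition bar_submod : {pred dup_mod M J} :=
  [pred x | ((\val x).2 \in F) &&
            ((\val x).1 - (\val x).2 \in ideal_mul M J)].

Fact dup_submod_closed : submod_closed dup_submod.
Proof.
split=> [|r x y]; first by apply/andP; rewrite /= subrr !rpred0.
move=> /andP[Fx _] /andP[Fy _]; apply/andP; split; last exact: (valP (r *: x + y)).
by rewrite /= rpredD // rpredZ.
Qed.
HB.instance Definition _ := GRing.isSubmodClosed.Build
  (dup_ring J) (dup_mod M J) dup_submod dup_submod_closed.

Fact bar_submod_closed : submod_closed bar_submod.
Proof.
split=> [|r x y]; first by apply/andP; rewrite /= subrr !rpred0.
move=> /andP[Fx _] /andP[Fy _]; apply/andP; split; last exact: (valP (r *: x + y)).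
by rewrite /= rpredD // rpredZ.
Qed.
HB.instance Definition _ := GRing.isSubmodClosed.Build
  (dup_ring J) (dup_mod M J) bar_submod bar_submod_closed.

End DupSubmod.
Arguments dup_submod {R M} J F.
Arguments bar_submod {R M} J F.

(* Main.v *)
Require Import Defs.
From mathcomp Require Import all_boot all_order all_algebra.
From mathcomp Require Import boolp.

Set Implicit Arguments.
Unset Strict Implicit.
Unset Printing Implicit Defensive.

Import GRing.Theory.
Local Open Scope ring_scope.

(** Each of the two coordinate projections of the duplicated module onto [M] is
    surjective, and semilinear over the corresponding coordinate projection of
    the duplicated ring onto [R], which is a surjective multiplicative map; the
    diagonal embeddings are sections of all four projections. The submodule
    [dup_submod J F] is the preimage of [F] under the first projection, and
    [bar_submod J N2] is the preimage of [N2] under the second one, since the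
    congruence modulo [J M] already holds for every element of the duplicated
    module. Both equivalences are therefore instances of one fact: being
    2-absorbing is preserved and reflected by taking preimages under a
    surjective semilinear map ([two_absorbing_preim]). *)

(** Only compatibility with multiplication and scaling is needed: the
    2-absorbing condition does not mention addition. *)
Lemma two_absorbing_preim (S R : comPzRingType) (N : lmodType S)
    (M : lmodType R) (f : S -> R) (g : N -> M)
    (G : submodClosed N) (F : submodClosed M) :
    {morph f : a b / a * b} -> (forall a x, g (a *: x) = f a *: g x) ->
    (forall r, exists a, f a = r) -> (forall m, exists x, g x = m) ->
    (forall x, (x \in G) = (g x \in F)) ->
  two_absorbing G <-> two_absorbing F.
Proof.
move=> fM gZ f_surj g_surj GE.
have resE a : (a \in residual G) = (f a \in residual F).
  apply/asboolP/asboolP => [aG m|aF x]; last by rewrite GE gZ.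
  by have [x <-] := g_surj m; rewrite -gZ -GE.
split=> -[[x nx] abs]; split.
- by exists (g x); rewrite -GE.
- move=> a b m; have [a' <-] := f_surj a; have [b' <-] := f_surj b.
  have [y <-] := g_surj m.
  by rewrite -fM -!gZ -!GE -resE; exact: abs.
- by have [y yx] := g_surj x; exists y; rewrite GE yx.
- by move=> a b y; rewrite resE !GE !gZ fM; exact: abs.
Qed.

Section Diagonal.
Variables (R : comPzRingType) (J : submodClosed R^o) (M : lmodType R).

Lemma dup_ring_diag (r : R) : exists a : dup_ring J, val a = (r, r).
Proof.
have rr : (r, r) \in dup_ring_pred J.
  by rewrite dup_ringP /= subrr; exact: (rpred0 J).
by exists (DupRing rr).
Qed.

Lemma dup_mod_diag (m : M) : exists x : dup_mod M J, val x = (m, m).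
Proof.
have mm : (m, m) \in dup_mod_pred M J by rewrite dup_modE /= subrr rpred0.
by exists (DupMod mm).
Qed.

Lemma mem_dup_submod (F : submodClosed M) (x : dup_mod M J) :
  (x \in dup_submod J F) = ((val x).1 \in F).
Proof. by rewrite inE [X in _ && X](valP x) andbT. Qed.

Lemma mem_bar_submod (F : submodClosed M) (x : dup_mod M J) :
  (x \in bar_submod J F) = ((val x).2 \in F).
Proof. by rewrite inE [X in _ && X](valP x) andbT. Qed.

End Diagonal.

Theorem corollary3p1 (R : comPzRingType) (J : submodClosed R^o)
    (M : lmodType R) (F N2 : submodClosed M) :
  (two_absorbing (dup_submod J F) <-> two_absorbing F) /\
  (two_absorbing (bar_submod J N2) <-> two_absorbing N2).
Proof.
split.
- apply: (@two_absorbing_preim _ _ _ _ (fun a : dup_ring J => (val a).1)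
    (fun x : dup_mod M J => (val x).1)) => //.
  + by move=> r; have [a aE] := dup_ring_diag J r; exists a; rewrite aE.
  + by move=> m; have [x xE] := dup_mod_diag J m; exists x; rewrite xE.
  + exact: mem_dup_submod.
- apply: (@two_absorbing_preim _ _ _ _ (fun a : dup_ring J => (val a).2)
    (fun x : dup_mod M J => (val x).2)) => //.
  + by move=> r; have [a aE] := dup_ring_diag J r; exists a; rewrite aE.
  + by move=> m; have [x xE] := dup_mod_diag J m; exists x; rewrite xE.
  + exact: mem_bar_submod.
Qed.
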